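(* Let $X,Y,Z,U_J,U_K$ be nonempty sets, and let $J\colon X\times Y\to U_J$ and $K\colon Y\times Z\to U_K$ be functions. Assume that $\operatorname{ran}(K)=\operatorname{ran}(K_2^a)$ for some $a\in Z$, and let $F\in\mathcal{F}_{J,K}$. Then there exists a function $f\colon U_J\to\operatorname{ran}(F)$ such that $F=f\circ R_k$ for every $k\in Q(K_2^a)$, where $R_k\colon X\times Y\times Z\to U_J$ is defined by $$R_k(x,y,z)=J(x,k(K(y,z))).$$
   Context: For a function $h$, $\operatorname{dom}(h)$ and $\operatorname{ran}(h)$ denote its domain and range. $\mathcal{F}_{J,K}$ is the class of functions $F\colon X\times Y\times Z\to\operatorname{ran}(F)$ for which there exist $G\colon U_J\times Z\to\operatorname{ran}(F)$ and $H\colon X\times U_K\to\operatorname{ran}(F)$ such that $F(x,y,z)=G(J(x,y),z)=H(x,K(y,z))$ for all $x\in X$, $y\in Y$, $z\in Z$. For $a\in Z$, the section $K_2^a\colon Y\to U_K$ is defined by $K_2^a(y)=K(y,a)$. $Q(h)$ denotes the set of quasi-inverses of a function $h$: a function $g$ is a quasi-inverse of $h$ if $\operatorname{ran}(h)\subseteq\operatorname{dom}(g)$, $\operatorname{ran}(g)\subseteq\operatorname{dom}(h)$, $h\circ g|_{\operatorname{ran}(h)}=\mathrm{id}_{\operatorname{ran}(h)}$, and $\operatorname{ran}(g|_{\operatorname{ran}(h)})=\operatorname{ran}(g)$. The Axiom of Choice is assumed, so every function has a quasi-inverse. *)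

(* Defs.v *)
From mathcomp Require Import all_boot.
From mathcomp Require Import boolp classical_sets functions.

Set Implicit Arguments.
Unset Strict Implicit.
Unset Printing Implicit Defensive.

Local Open Scope classical_set_scope.

(* A set is a type and a function h : A -> B has dom(h) = A.  Functions whose
   domain is only a subset of a type, such as quasi-inverses, are [pfun]s.
   The range of a function, used as a codomain, is the subtype [range h]. *)
Record pfun (A B : Type) := PFun { dom : set A ; app :> dom -> B }.

(* ran(g) is contained in dom(h) = A by typing.  The last clause is
   ran(g|_ran(h)) = ran(g). *)
Definition quasi_inverses (A B : Type) (h : A -> B) : set (pfun B A) :=
  [set g | [/\ range h `<=` dom g,
               forall b : dom g, range h (set_val b) -> h (g b) = set_val b
             & g @` [set b : dom g | range h (set_val b)] = range g]].

Definition section2 (Y Z U : Type) (K : Y * Z -> U) (a : Z) : Y -> U :=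
  fun y => K (y, a).

Definition FJK (X Y Z UJ UK W : Type) (J : X * Y -> UJ) (K : Y * Z -> UK) :
    set (X * Y * Z -> W) :=
  [set F | exists (G : UJ * Z -> range F) (H : X * UK -> range F),
     forall x y z, F (x, y, z) = set_val (G (J (x, y), z)) /\
                   set_val (G (J (x, y), z)) = set_val (H (x, K (y, z)))].

(* [sub] makes k applicable to every value of K. *)
Definition Rmap (X Y Z UJ UK : Type) (J : X * Y -> UJ) (K : Y * Z -> UK)
    (k : pfun UK Y) (sub : range K `<=` dom k) : X * Y * Z -> UJ :=
  fun p => let: (x, y, z) := p in
    J (x, k (exist _ (K (y, z)) (mem_set (sub _ (imageT K (y, z)))))).

Lemma ran_sub_dom (Y Z UK : Type) (K : Y * Z -> UK) (a : Z)
    (hK : range K = range (section2 K a)) (k : pfun UK Y)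
    (hk : quasi_inverses (section2 K a) k) : range K `<=` dom k.
Proof. by rewrite hK; case: hk. Qed.

(* Main.v *)
(* Take f u = G (u, a).  If k is a quasi-inverse of K_2^a and y' = k (K (y, z)),
   then K (y', a) = K (y, z), so F = H (x, K _) gives F (x, y, z) = F (x, y', a),
   which is G (J (x, y'), a). *)
Require Import Defs.
From mathcomp Require Import all_boot.
From mathcomp Require Import boolp classical_sets functions.

Local Open Scope classical_set_scope.

(** Through [H], the value of [F] depends on [(y, z)] only via [K (y, z)]. By [hK] that value is
    also attained at some [(y', a)], and with the last coordinate frozen at [a], [G] sees only
    [J (x, y')]. *)

Theorem theorem3 (X Y Z UJ UK W : Type)
    (hX : inhabited X) (hY : inhabited Y) (hZ : inhabited Z)
    (hUJ : inhabited UJ) (hUK : inhabited UK)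
    (J : X * Y -> UJ) (K : Y * Z -> UK) (a : Z)
    (hK : range K = range (section2 K a))
    (F : X * Y * Z -> W) (hF : FJK J K F) :
  exists f : UJ -> range F,
    forall (k : pfun UK Y) (hk : quasi_inverses (section2 K a) k),
      F = set_val \o (f \o Rmap J (ran_sub_dom hK hk)).
Proof.
case: hF => G [H FGH].
(* The witness is chosen before [k], so one [f] serves all quasi-inverses. *)
exists (fun u => G (u, a)) => k hk.
apply/funext => -[[x y] z] /=.
set b := exist _ _ _.
have Kkb : K (k b, a) = K (y, z).
  case: (hk) => _ + _; apply.
  (* [k] is a right inverse only on the range of [section2 K a]; [hK] puts [K (y, z)] there. *)
  by rewrite -hK; exact: imageT.
have FH x' y' z' : F (x', y', z') = set_val (H (x', K (y', z'))).
  by have [-> ->] := FGH x' y' z'.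
by rewrite FH -Kkb -FH; have [] := FGH x (k b) a.
Qed.
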